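(* If $\lambda\in\mathbb{C}\setminus\mathbb{R}$ is an eigenvalue of $\mathsf{H}_\mu$ with an eigenfunction $u$, then $\overline\lambda$ is also an eigenvalue of $\mathsf{H}_\mu$ with an eigenfunction $\overline u$. Moreover, the geometric multiplicities of $\lambda$ and $\overline\lambda$ coincide.
   Context: Let $d\ge 2$ and let $\Omega\subset\mathbb{R}^d$ be a bounded, connected, $C^2$-smooth open set. Let $a\colon\Omega\to M_d(\mathbb{R})$ be a symmetric matrix function with real-valued entries in $C^1(\overline\Omega)$ such that for some $c>0$ one has $\xi\cdot a(x)\xi\ge c|\xi|^2$ for all $\xi\in\mathbb{R}^d$, $x\in\Omega$. Function spaces are complex-valued. Let $\mu$ be a Radon probability measure on $\Omega$ such that $H^2(\Omega)\ni u\mapsto \langle u\rangle_\mu := \int_\Omega u\,d\mu$ is a continuous functional on $H^2(\Omega)$. Write $\nabla\cdot a\nabla u=\sum_{i,j}\partial_i(a_{ij}\partial_j u)$. In the Hilbert space $L^2(\Omega)$ define the operator $$\mathsf{H}_\mu u := -\nabla\cdot a\nabla u,\qquad \mathrm{dom}\,\mathsf{H}_\mu := \{u\in H^2(\Omega): u|_{\partial\Omega}=\langle u\rangle_\mu\}$$ (the trace of $u$ on $\partial\Omega$ equals the constant $\langle u\rangle_\mu$). *)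

(* Defs.v *)
From HB Require Import structures.
From mathcomp Require Import all_boot all_order all_algebra complex.
From mathcomp Require Import all_classical all_reals all_analysis.

Set Implicit Arguments.
Unset Strict Implicit.
Unset Printing Implicit Defensive.
Import Order.TTheory GRing.Theory Num.Theory.
Import numFieldNormedType.Exports.
Import ComplexField.Normc.

Local Open Scope classical_set_scope.
Local Open Scope ring_scope.
Local Open Scope complex_scope.

(* Matrices carry the sigma-algebra generated by their coefficients; on 'rV[R]_n
   this is the Borel sigma-algebra of R^n. *)
Definition mx_display : measure_display -> measure_display.
Proof. exact. Qed.

Section measurable_matrix.
Context {d} {T : measurableType d} (m n : nat).

Definition mx_coef_preimages : set (set 'M[T]_(m, n)) :=
  [set X | exists i j, exists2 B : set T,
             measurable B & X = (fun A : 'M[T]_(m, n) => A i j) @^-1` B].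

Let mx_set0 : <<s mx_coef_preimages >> set0.
Proof. exact: sigma_algebra0. Qed.

Let mx_setC A : <<s mx_coef_preimages >> A -> <<s mx_coef_preimages >> (~` A).
Proof. exact: sigma_algebraC. Qed.

Let mx_bigcup (F : _^nat) : (forall i, <<s mx_coef_preimages >> (F i)) ->
  <<s mx_coef_preimages >> (\bigcup_i (F i)).
Proof. exact: sigma_algebra_bigcup. Qed.

HB.instance Definition _ := @isMeasurable.Build (mx_display d)
  'M[T]_(m, n) <<s mx_coef_preimages >> mx_set0 mx_setC mx_bigcup.

Lemma measurable_mx_coef (i : 'I_m) (j : 'I_n) :
  measurable_fun [set: 'M[T]_(m, n)] (fun A : 'M[T]_(m, n) => A i j).
Proof.
move=> _ B mB; rewrite setTI; apply: sub_sigma_algebra.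
by exists i, j, B.
Qed.

End measurable_matrix.

Section rV_cons.
Context {R : realType} {n : nat}.

Definition rV_cons (p : measurableTypeR R * 'rV[R]_n) :
  'rV[R]_n.+1 := row_mx (const_mx p.1 : 'rV_1) p.2.

Lemma measurable_rV_cons : measurable_fun setT rV_cons.
Proof.
apply: (measurability (@mx_coef_preimages _ R 1 n.+1)).
  by [].
move=> _ [_ [i [j [B mB ->]]] <-]; rewrite setTI -comp_preimage.
rewrite -[X in measurable X]setTI.
suff: measurable_fun setT
  ((fun A : 'rV[R]_n.+1 => A i j) \o rV_cons) by apply.
case: (@split_ordP 1 n j) => k ->.
  rewrite (_ : _ \o _ = fst); first exact: measurable_fst.
  apply/funext => p; exact: etrans (row_mxEl _ p.2 i k) (mxE _ _ _ _).
rewrite (_ : _ \o _ = (fun A : 'rV_n => A i k) \o snd).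
  by apply: measurableT_comp; [exact: measurable_mx_coef|exact: measurable_snd].
by apply/funext => p; exact: (row_mxEr (const_mx p.1 : 'rV_1) p.2 i k).
Qed.

Definition rV_uncons (v : 'rV[R]_n.+1) :
    measurableTypeR R * 'rV[R]_n :=
  (v 0 0, rsubmx (v : 'rV_(1 + n))).

Lemma rV_consK : cancel rV_cons rV_uncons.
Proof.
move=> [x v]; congr (_, _); last exact: row_mxKr.
rewrite (_ : 0 = lshift n (0 : 'I_1) :> 'I_n.+1); last exact: val_inj.
exact: etrans (row_mxEl (const_mx x : 'rV_1) v 0 0) (mxE _ _ _ _).
Qed.

Lemma measurable_rV_uncons : measurable_fun setT rV_uncons.
Proof.
apply/measurable_fun_pairP; split => /=; first exact: measurable_mx_coef.
apply: (measurability (@mx_coef_preimages _ R 1 n)).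
  by [].
move=> _ [_ [i [j [B mB ->]]] <-]; rewrite setTI -comp_preimage.
rewrite (_ : _ \o _ = fun A : 'rV[R]_n.+1 => A i (rshift 1 j)).
  by rewrite -[X in measurable X]setTI; exact: measurable_mx_coef.
by apply/funext => A /=; rewrite mxE.
Qed.

End rV_cons.

Section lebesgue_rV_cons.
Context {R : realType} {n : nat}.
Variable nu : {sigma_finite_measure set 'rV[R]_n -> \bar R}.
Local Open Scope ereal_scope.

Definition lebesgue_rV_cons : set 'rV[R]_n.+1 -> \bar R :=
  pushforward (lebesgue_measure \x nu) rV_cons.

Let m0 : lebesgue_rV_cons set0 = 0.
Proof. by rewrite /lebesgue_rV_cons /pushforward preimage_set0 measure0. Qed.

Let m_ge0 A : 0 <= lebesgue_rV_cons A.
Proof. by rewrite /lebesgue_rV_cons /pushforward; exact: measure_ge0. Qed.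

Let m_sigma_additive : semi_sigma_additive lebesgue_rV_cons.
Proof.
have mp X : measurable X -> measurable (@rV_cons R n @^-1` X).
  by move=> mX; rewrite -[X in measurable X]setTI; exact: measurable_rV_cons.
move=> F mF tF mUF; rewrite /lebesgue_rV_cons /pushforward preimage_bigcup.
apply: measure_semi_sigma_additive.
- by move=> k; exact: mp.
- apply/trivIsetP => /= i j _ _ ij; rewrite -preimage_setI.
  by move/trivIsetP : tF => /(_ _ _ _ _ ij) ->//; rewrite preimage_set0.
- by rewrite -preimage_bigcup; exact: mp.
Qed.

HB.instance Definition _ := isMeasure.Build _ _ _ lebesgue_rV_cons
  m0 m_ge0 m_sigma_additive.

Let m_sigma_finite : sigma_finite setT lebesgue_rV_cons.
Proof.
have /sigma_finiteP[F [TF ndF Foo]] :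
  sigma_finite setT (@lebesgue_measure R) := sigma_finiteT _.
have /sigma_finiteP[G [TG ndG Goo]] := sigma_finiteT nu.
exists (fun k => @rV_uncons R n @^-1` (F k `*` G k)).
  apply/esym; rewrite -subTset => v _.
  have [i _ Fi] : (\bigcup_i F i) (rV_uncons v).1 by rewrite -TF.
  have [j _ Gj] : (\bigcup_i G i) (rV_uncons v).2 by rewrite -TG.
  exists (maxn i j) => //; split => /=.
  - by move: Fi; exact/subsetPset/ndF/leq_maxl.
  - by move: Gj; exact/subsetPset/ndG/leq_maxr.
move=> k; have [mF Fk] := Foo k; have [mG Gk] := Goo k; split.
  rewrite -[X in measurable X]setTI; apply: measurable_rV_uncons => //.
  exact: measurableX.
rewrite /lebesgue_rV_cons /pushforward -comp_preimage.
rewrite (_ : rV_uncons \o rV_cons = id) ?preimage_id//.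
  by rewrite product_measure1E// lte_mul_pinfty// ge0_fin_numE.
by apply/funext => p /=; rewrite rV_consK.
Qed.

HB.instance Definition _ := Measure_isSigmaFinite.Build _ _ _
  lebesgue_rV_cons m_sigma_finite.

End lebesgue_rV_cons.

(* Lebesgue measure on 'rV[R]_n = R^n: on R^(n+1) it is the product of the
   one-dimensional one and the one on R^n, transported along
   (x, v) |-> row_mx x v. *)
Fixpoint lebesgue_rV (R : realType) (n : nat) :
    {sigma_finite_measure set 'rV[R]_n -> \bar R} :=
  match n return {sigma_finite_measure set 'rV[R]_n -> \bar R} with
  | 0 => @dirac _ 'rV[R]_0 (const_mx (0 : R)) R
  | k.+1 => @lebesgue_rV_cons R k (lebesgue_rV R k)
  end.

Section euclidean.
Context {R : realType} {n : nat}.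

(* The library norm on matrices is the sup norm. *)
Definition enorm (x : 'rV[R]_n) : R := Num.sqrt (\sum_(j < n) x 0 j ^+ 2).

Definition ediam (A : set 'rV[R]_n) : \bar R :=
  ereal_sup (0%E |` [set (enorm (x.1 - x.2))%:E | x in A `*` A]).

Definition hausdorff_delta (s : nat) (delta : R) (A : set 'rV[R]_n) : \bar R :=
  ereal_inf [set (\sum_(0 <= k <oo) ediam (F k) ^+ s)%E | F in
    [set F : (set 'rV[R]_n)^nat |
      A `<=` \bigcup_k F k /\ forall k, (ediam (F k) <= delta%:E)%E]].

(* The s-dimensional Hausdorff (outer) measure of R^n, s > 0, without the
   usual normalizing constant. Integrals against it only look at its values on
   measurable (Borel) sets, where it is a measure. For s = n - 1 and on a C^2
   hypersurface it is a positive constant times the surface measure. *)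
Definition hausdorff (s : nat) (A : set 'rV[R]_n) : \bar R :=
  ereal_sup [set hausdorff_delta s delta A | delta in [set delta | 0 < delta]].

Definition pderiv (l : seq 'I_n) (f : 'rV[R]_n -> R) : 'rV[R]_n -> R :=
  foldr (fun j g x => 'D_(delta_mx 0 j) g x) f l.

Definition is_Ck (k : nat) (f : 'rV[R]_n -> R) : Prop :=
  forall l : seq 'I_n,
    ((size l <= k)%N -> continuous (pderiv l f)) /\
    ((size l < k)%N -> forall j x, derivable (pderiv l f) x (delta_mx 0 j)).

End euclidean.

Section domains.
Context {R : realType} {n : nat}.

Definition test_function (Omega : set 'rV[R]_n) (phi : 'rV[R]_n -> R) : Prop :=
  (forall k, is_Ck k phi) /\
  exists2 K, compact K /\ K `<=` Omega & forall x, ~ K x -> phi x = 0.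

Definition extends_continuously (Omega : set 'rV[R]_n) (f : 'rV[R]_n -> R) :=
  exists2 g : 'rV[R]_n -> R, {within closure Omega, continuous g} &
    {in Omega, g =1 f}.

Definition C1_closure (Omega : set 'rV[R]_n) (f : 'rV[R]_n -> R) : Prop :=
  extends_continuously Omega f /\
  forall j : 'I_n,
    (forall x, Omega x -> derivable f x (delta_mx 0 j)) /\
    extends_continuously Omega (fun x => 'D_(delta_mx 0 j) f x).

Definition boundary (Omega : set 'rV[R]_n) := closure Omega `\` interior Omega.

(* Near each boundary point, Omega lies strictly on one side of the graph of a
   C^2 function which expresses the coordinate j through the other ones; eps
   chooses the side. *)
Definition C2_smooth (Omega : set 'rV[R]_n) : Prop :=
  forall x0, boundary Omega x0 ->
  exists (j : 'I_n) (eps : bool) (gamma : 'rV[R]_n.-1 -> R) (r : R),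
    [/\ 0 < r, is_Ck 2 gamma &
      forall x, enorm (x - x0) < r ->
        (Omega x <-> 0 < (-1) ^+ eps * (x 0 j - gamma (col' j x)))].

End domains.

Section sobolev.
Context {R : realType} {n : nat}.
Implicit Types (Omega : set 'rV[R]_n) (u v g : 'rV[R]_n -> R[i]).
Local Notation leb := (lebesgue_rV R n).

Definition cintegral d (T : measurableType d) (mu : {measure set T -> \bar R})
    (D : set T) (f : T -> R[i]) : R[i] :=
  (\int[mu]_(x in D) complex.Re (f x)) +i* (\int[mu]_(x in D) complex.Im (f x)).

Definition L2normsq Omega u : \bar R :=
  (\int[leb]_(x in Omega) (normc (u x) ^+ 2)%:E)%E.

(* Elements of L^2(Omega) are represented by Borel functions; representatives
   equal almost everywhere on Omega are identified, and the values outside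
   Omega are irrelevant. *)
Definition in_L2 Omega u : Prop :=
  [/\ measurable_fun Omega (fun x => complex.Re (u x)),
      measurable_fun Omega (fun x => complex.Im (u x)) &
      (L2normsq Omega u < +oo)%E].

Definition weak_deriv Omega (l : seq 'I_n) u g : Prop :=
  forall phi, test_function Omega phi ->
    cintegral leb Omega (fun x => u x * (pderiv l phi x)%:C) =
    (-1) ^+ size l * cintegral leb Omega (fun x => g x * (phi x)%:C).

Definition in_H Omega (k : nat) u : Prop :=
  in_L2 Omega u /\
  forall l, (size l <= k)%N -> exists2 g, in_L2 Omega g & weak_deriv Omega l u g.

(* Convergence for the H^k(Omega) norm. *)
Definition cvg_H Omega (k : nat) (u_ : nat -> 'rV[R]_n -> R[i]) u : Prop :=
  forall l, (size l <= k)%N ->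
  exists2 g_ : nat -> 'rV[R]_n -> R[i],
    forall m, in_L2 Omega (g_ m) /\
              weak_deriv Omega l (fun x => u_ m x - u x) (g_ m) &
    L2normsq Omega (g_ m) @[m --> \oo] --> 0%E.

Definition continuous_closure Omega u : Prop :=
  {within closure Omega, continuous (fun x => complex.Re (u x))} /\
  {within closure Omega, continuous (fun x => complex.Im (u x))}.

(* u|_(boundary of Omega) = g: the trace operator on H^1(Omega) is the extension
   by continuity of the restriction H^1(Omega) /\ C(closure) -> L^2(boundary). *)
Definition has_trace Omega u g : Prop :=
  exists u_ : nat -> 'rV[R]_n -> R[i],
    [/\ forall m, in_H Omega 1 (u_ m) /\ continuous_closure Omega (u_ m),
        cvg_H Omega 1 u_ u &
        (\int[hausdorff n.-1]_(x in boundary Omega)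
           (normc (u_ m x - g x) ^+ 2)%:E)%E @[m --> \oo] --> 0%E].

(* A Borel probability measure on R^n which lives on Omega, i.e. a probability
   measure on Omega, and is inner regular there. *)
Definition radon_probability_on Omega (mu : probability 'rV[R]_n R) : Prop :=
  mu Omega = 1%E /\
  forall A, measurable A -> A `<=` Omega ->
    mu A = ereal_sup [set mu K | K in [set K | compact K /\ K `<=` A]].

Definition in_H2C Omega u : Prop := in_H Omega 2 u /\ continuous_closure Omega u.

(* u |-> \int_Omega u dmu is a continuous functional on H^2(Omega). As mu may
   charge Lebesgue-null sets, the integral is meaningful for the continuous
   representative; H^2(Omega) /\ C(closure) is all of H^2(Omega) for n <= 3 and
   is dense in H^2(Omega) for every n. *)
Definition mean_continuous Omega (mu : probability 'rV[R]_n R) : Prop :=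
  forall (u_ : nat -> 'rV[R]_n -> R[i]) u,
    (forall m, in_H2C Omega (u_ m)) -> in_H2C Omega u -> cvg_H Omega 2 u_ u ->
    normc (cintegral mu Omega (u_ m) - cintegral mu Omega u) @[m --> \oo]
      --> (0 : R).

(* <u>_mu = z, by continuous extension to H^2(Omega). *)
Definition has_mean Omega (mu : probability 'rV[R]_n R) u (z : R[i]) : Prop :=
  exists u_ : nat -> 'rV[R]_n -> R[i],
    [/\ forall m, in_H2C Omega (u_ m), cvg_H Omega 2 u_ u &
        normc (cintegral mu Omega (u_ m) - z) @[m --> \oo] --> (0 : R)].

(* f = - div (a grad u) almost everywhere on Omega, in the sense of weak
   derivatives: Du j = d_j u and F i j = d_i (a_ij d_j u). *)
Definition elliptic_operator Omega (a : 'rV[R]_n -> 'M[R]_n) u f : Prop :=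
  exists (Du : 'I_n -> 'rV[R]_n -> R[i]) (F : 'I_n -> 'I_n -> 'rV[R]_n -> R[i]),
    [/\ forall j, in_L2 Omega (Du j) /\ weak_deriv Omega [:: j] u (Du j),
        forall i j, in_L2 Omega (F i j) /\
          weak_deriv Omega [:: i] (fun x => (a x i j)%:C * Du j x) (F i j) &
        {ae leb, forall x, Omega x -> f x = - \sum_i \sum_j F i j x}].

Definition dom_Hmu Omega mu u : Prop :=
  in_H Omega 2 u /\
  exists2 z, has_mean Omega mu u z & has_trace Omega u (fun=> z).

(* f = H_mu u in L^2(Omega). *)
Definition Hmu Omega a mu u f : Prop :=
  [/\ dom_Hmu Omega mu u, in_L2 Omega f & elliptic_operator Omega a u f].

Definition in_Hmu_eigenspace Omega a mu (lambda : R[i]) u : Prop :=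
  Hmu Omega a mu u (fun x => lambda * u x).

Definition Hmu_eigenfunction Omega a mu (lambda : R[i]) u : Prop :=
  in_Hmu_eigenspace Omega a mu lambda u /\
  ~ {ae leb, forall x, Omega x -> u x = 0}.

Definition Hmu_eigenvalue Omega a mu (lambda : R[i]) : Prop :=
  exists u, Hmu_eigenfunction Omega a mu lambda u.

Definition lin_indep Omega (k : nat) (v : 'I_k -> 'rV[R]_n -> R[i]) : Prop :=
  forall c : 'I_k -> R[i],
    {ae leb, forall x, Omega x -> \sum_i c i * v i x = 0} -> forall i, c i = 0.

(* The dimension of the eigenspace as a subspace of L^2(Omega). *)
Definition geometric_multiplicity Omega a mu (lambda : R[i]) : \bar R :=
  ereal_sup [set k%:R%:E | k in [set k : nat |
    exists v : 'I_k -> 'rV[R]_n -> R[i],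
      (forall i, in_Hmu_eigenspace Omega a mu lambda (v i)) /\ lin_indep Omega v]].

End sobolev.

(* Main.v *)
Require Import Defs.
From HB Require Import structures.
From mathcomp Require Import all_boot all_order all_algebra complex.
From mathcomp Require Import all_classical all_reals all_analysis.
From mathcomp Require Import measurable_realfun.
Import Order.TTheory GRing.Theory Num.Theory.
Import numFieldNormedType.Exports.
Local Open Scope classical_set_scope.
Local Open Scope ring_scope.
Local Open Scope complex_scope.

(** The coefficients of the operator, the measure and the test functions are
    real, and conjugation is an isometric, conjugate-linear involution of
    L^2(Omega).  It therefore commutes with every ingredient of [Hmu]: integrals,
    weak derivatives, Sobolev convergence, the trace and the mean.  Hence
    [Hmu u = f] gives [Hmu u^* = f^*] ([Hmu_conj]), and with [f = lambda u]
    conjugation sends the eigenspace of [lambda] into that of [lambda^*].  Being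
    an involution that preserves linear independence, it sends the independent
    families counted by one multiplicity to those counted by the other, in both
    directions. *)

(** * Conjugation, integrals and L^2 *)

Section conjugation.
Context {R : realType}.
Implicit Type z : R[i].

Definition fconj {T : Type} (u : T -> R[i]) : T -> R[i] := fun x => conjc (u x).

Lemma Re_conjc z : complex.Re z^* = complex.Re z.
Proof. by case: z. Qed.

Lemma Im_conjc z : complex.Im z^* = - complex.Im z.
Proof. by case: z. Qed.

Lemma normc_conjc z : ComplexField.Normc.normc z^* = ComplexField.Normc.normc z.
Proof. by case: z => x y /=; rewrite sqrrN. Qed.

(* The morphism laws, stated so that the results display [conjc] itself
   rather than its bundled morphism. *)
Lemma conjcN z : (- z)^* = - conjc z.
Proof. exact: rmorphN. Qed.

Lemma conjcB z1 z2 : (z1 - z2)^* = conjc z1 - conjc z2.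
Proof. exact: rmorphB. Qed.

Lemma conjcM z1 z2 : (z1 * z2)^* = conjc z1 * conjc z2.
Proof. exact: rmorphM. Qed.

Lemma conjc_sum (I : Type) (r : seq I) (P : pred I) (F : I -> R[i]) :
  (\sum_(i <- r | P i) F i)^* = \sum_(i <- r | P i) conjc (F i).
Proof. exact: rmorph_sum. Qed.

Lemma conjc_eq0P z : (z^* = 0) <-> (z = 0).
Proof. by split=> /eqP; rewrite ?conjc_eq0 => /eqP // ->; exact: conjc0. Qed.

(** Integrability is not assumed: if the positive and the negative part both
    have infinite integral, then [f] and [- f] both have integral [-oo], hence
    real-valued integral [0]. *)
Lemma RintegralN_total d (T : measurableType d) (mu : {measure set T -> \bar R})
    (D : set T) (f : T -> R) :
  \int[mu]_(x in D) (- f x) = - \int[mu]_(x in D) f x.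
Proof.
rewrite /Rintegral integralE [in RHS]integralE.
under [X in (X - _)%E]eq_integral do rewrite (funeposN (EFin \o f)).
under [X in (_ - X)%E]eq_integral do rewrite (funenegN (EFin \o f)).
case: (integral _ _ _) => [x| |]; case: (integral _ _ _) => [y| |] //=;
  rewrite ?oppr0 //.
by rewrite opprB.
Qed.

Lemma cintegral_conj d (T : measurableType d) (mu : {measure set T -> \bar R})
    (D : set T) (f : T -> R[i]) :
  cintegral mu D (fconj f) = (cintegral mu D f)^*.
Proof.
rewrite /cintegral /fconj /=; congr (_ +i* _).
  by under eq_Rintegral do rewrite Re_conjc.
under eq_Rintegral do rewrite Im_conjc.
exact: RintegralN_total.
Qed.

End conjugation.

Section sobolev_conjugation.
Context {R : realType} {n : nat}.
Implicit Types (Omega : set 'rV[R]_n) (u v f g : 'rV[R]_n -> R[i]).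

Lemma L2normsq_conj Omega u : L2normsq Omega (fconj u) = L2normsq Omega u.
Proof.
by rewrite /L2normsq; under eq_integral do rewrite /fconj normc_conjc.
Qed.

Lemma in_L2_conj Omega u : in_L2 Omega u -> in_L2 Omega (fconj u).
Proof.
move=> [mRe mIm finu]; split; last by rewrite L2normsq_conj.
  by rewrite (_ : (fun x => _) = fun x => complex.Re (u x))//;
     apply/funext => x; rewrite Re_conjc.
rewrite (_ : (fun x => _) = fun x => - complex.Im (u x)).
  exact: measurable_funN.
by apply/funext => x; rewrite Im_conjc.
Qed.

Lemma continuous_closure_conj Omega u :
  continuous_closure Omega u -> continuous_closure Omega (fconj u).
Proof.
move=> [cRe cIm]; split.
  by rewrite (_ : (fun x => _) = fun x => complex.Re (u x))//;
     apply/funext => x; rewrite Re_conjc.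
rewrite (_ : (fun x => _) = fun x => - complex.Im (u x)).
  by move=> x; apply: cvgN; exact: cIm.
by apply/funext => x; rewrite Im_conjc.
Qed.

(** * Sobolev spaces, traces and means *)

(** Test functions are real-valued. *)
Lemma weak_deriv_conj Omega l u g :
  weak_deriv Omega l u g -> weak_deriv Omega l (fconj u) (fconj g).
Proof.
have conjM v (psi : 'rV[R]_n -> R) :
    (fun x => fconj v x * (psi x)%:C) = fconj (fun x => v x * (psi x)%:C).
  by apply/funext => x; rewrite /fconj conjcM conjc_real.
move=> ug phi tphi; rewrite !conjM !cintegral_conj ug//.
by rewrite conjcM rmorphXn rmorphN1.
Qed.

Lemma in_H_conj Omega k u : in_H Omega k u -> in_H Omega k (fconj u).
Proof.
move=> [u2 du]; split; first exact: in_L2_conj.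
move=> l /du[g g2 ug]; exists (fconj g); first exact: in_L2_conj.
exact: weak_deriv_conj.
Qed.

Lemma cvg_H_conj Omega k (u_ : nat -> 'rV[R]_n -> R[i]) u :
  cvg_H Omega k u_ u -> cvg_H Omega k (fun m => fconj (u_ m)) (fconj u).
Proof.
move=> uu l /uu[g_ ug g0]; exists (fun m => fconj (g_ m)).
  move=> m; have [g2 dg] := ug m; split; first exact: in_L2_conj.
  rewrite (_ : (fun x => _) = fconj (fun x => u_ m x - u x)).
    exact: weak_deriv_conj.
  by apply/funext => x; rewrite /fconj conjcB.
by under eq_fun do rewrite L2normsq_conj.
Qed.

Lemma has_trace_conj Omega u g :
  has_trace Omega u g -> has_trace Omega (fconj u) (fconj g).
Proof.
move=> [u_ [uH uu tr]]; exists (fun m => fconj (u_ m)); split.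
- move=> m; have [uHm cm] := uH m.
  by split; [exact: in_H_conj|exact: continuous_closure_conj].
- exact: cvg_H_conj.
- rewrite (_ : (fun m => _) = fun m => (\int[hausdorff n.-1]_(x in boundary Omega)
      (ComplexField.Normc.normc (u_ m x - g x) ^+ 2)%:E)%E)//.
  apply/funext => m; congr (integral _ _ _); apply/funext => x.
  by rewrite /fconj -conjcB normc_conjc.
Qed.

Lemma has_mean_conj Omega (mu : probability 'rV[R]_n R) u z :
  has_mean Omega mu u z -> has_mean Omega mu (fconj u) z^*.
Proof.
move=> [u_ [uH uu uz]]; exists (fun m => fconj (u_ m)); split.
- move=> m; have [uHm cm] := uH m.
  by split; [exact: in_H_conj|exact: continuous_closure_conj].
- exact: cvg_H_conj.
- by under eq_fun do rewrite cintegral_conj -conjcB normc_conjc.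
Qed.

(** * The operator and its eigenspaces *)

Lemma elliptic_operator_conj Omega a u f :
  elliptic_operator Omega a u f ->
  elliptic_operator Omega a (fconj u) (fconj f).
Proof.
move=> [Du [F [uD aF fF]]].
exists (fun j => fconj (Du j)), (fun i j => fconj (F i j)); split.
- move=> j; have [D2 dD] := uD j.
  by split; [exact: in_L2_conj|exact: weak_deriv_conj].
- move=> i j; have [F2 dF] := aF i j; split; first exact: in_L2_conj.
  rewrite (_ : (fun x => _) = fconj (fun x => (a x i j)%:C * Du j x)).
    exact: weak_deriv_conj.
  by apply/funext => x; rewrite /fconj conjcM conjc_real.
- apply: filterS fF => x fFx Ox; rewrite /fconj fFx// conjcN conjc_sum.
  by congr (- _); apply: eq_bigr => i _; rewrite conjc_sum.
Qed.

Lemma Hmu_conj Omega a mu u f :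
  Hmu Omega a mu u f -> Hmu Omega a mu (fconj u) (fconj f).
Proof.
move=> [[uH [z mz tz]] f2 ef]; split.
- split; first exact: in_H_conj.
  exists (conjc z); first exact: has_mean_conj.
  exact: (has_trace_conj _ _ _ tz).
- exact: in_L2_conj.
- exact: elliptic_operator_conj.
Qed.

Lemma in_Hmu_eigenspace_conj Omega a mu lambda u :
  in_Hmu_eigenspace Omega a mu lambda u ->
  in_Hmu_eigenspace Omega a mu lambda^* (fconj u).
Proof.
move=> /Hmu_conj; congr Hmu.
by apply/funext => x; rewrite /fconj conjcM.
Qed.

Lemma Hmu_eigenfunction_conj Omega a mu lambda u :
  Hmu_eigenfunction Omega a mu lambda u ->
  Hmu_eigenfunction Omega a mu lambda^* (fconj u).
Proof.
move=> [eu u0]; split; first exact: in_Hmu_eigenspace_conj.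
move=> cu0; apply: u0; apply: filterS cu0 => x cux Ox.
by apply/conjc_eq0P; exact: cux.
Qed.

(** A relation with coefficients [c] between the conjugates is the conjugate of
    a relation with coefficients [c^*] between the original functions. *)
Lemma lin_indep_conj Omega k (v : 'I_k -> 'rV[R]_n -> R[i]) :
  lin_indep Omega v -> lin_indep Omega (fun i => fconj (v i)).
Proof.
move=> vfree c cv0 i; apply/conjc_eq0P; apply: (vfree (fun i => conjc (c i))).
apply: filterS cv0 => x cvx Ox; apply/conjc_eq0P.
rewrite -[RHS](cvx Ox) conjc_sum.
by apply: eq_bigr => j _; rewrite conjcM conjcK.
Qed.

Lemma geometric_multiplicity_conj Omega a mu lambda :
  geometric_multiplicity Omega a mu lambda^* =
  geometric_multiplicity Omega a mu lambda.
Proof.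
have conj_family nu k :
    (exists v : 'I_k -> 'rV[R]_n -> R[i],
      (forall i, in_Hmu_eigenspace Omega a mu nu (v i)) /\ lin_indep Omega v) ->
    exists v : 'I_k -> 'rV[R]_n -> R[i],
      (forall i, in_Hmu_eigenspace Omega a mu nu^* (v i)) /\ lin_indep Omega v.
  move=> [v [ev vfree]]; exists (fun i => fconj (v i)).
  by split=> [i|]; [exact: in_Hmu_eigenspace_conj|exact: lin_indep_conj].
rewrite /geometric_multiplicity; congr (ereal_sup (image _ _)).
apply/seteqP; split=> k /conj_family //.
by rewrite conjcK.
Qed.

End sobolev_conjugation.

Theorem proposition2p6 (R : realType) (d : nat) (hd : (2 <= d)%N)
  (Omega : set 'rV[R]_d)
  (Omega_open : open Omega) (Omega_bounded : bounded_set Omega)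
  (Omega_connected : connected Omega) (Omega_C2 : C2_smooth Omega)
  (a : 'rV[R]_d -> 'M[R]_d)
  (a_sym : forall x, Omega x -> (a x)^T = a x)
  (a_C1 : forall i j, C1_closure Omega (fun x => a x i j))
  (a_elliptic : exists2 c : R, 0 < c & forall x (xi : 'rV[R]_d), Omega x ->
     c * enorm xi ^+ 2 <= (xi *m a x *m xi^T) 0 0)
  (mu : probability 'rV[R]_d R)
  (mu_radon : radon_probability_on Omega mu)
  (mu_cont : mean_continuous Omega mu)
  (lambda : R[i]) (lambda_nonreal : lambda \isn't Num.real)
  (u : 'rV[R]_d -> R[i]) (hu : Hmu_eigenfunction Omega a mu lambda u) :
  [/\ Hmu_eigenvalue Omega a mu lambda^*,
      Hmu_eigenfunction Omega a mu lambda^* (fun x => (u x)^*) &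
      geometric_multiplicity Omega a mu lambda =
      geometric_multiplicity Omega a mu lambda^*].
Proof.
have cu := Hmu_eigenfunction_conj _ _ _ _ _ hu.
split; [by exists (fconj u)|exact: cu|].
by rewrite geometric_multiplicity_conj.
Qed.
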